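(* Let $S$ be any set of $n\ge 2$ points in general position in the plane, and let $e_{123}(S)$ be the minimum number of edges in an OT-graph for $S$ when only Axioms 1, 2 and 3 are used. Then $$e_{123}(S)=\left\lfloor \frac{n}{2}\right\rfloor\left\lfloor\frac{n-1}{2}\right\rfloor .$$
   Context: General position means no three points are collinear. For distinct points $p,q,r$, write $pqr$ for the statement ''the ordered triple $(p,q,r)$ has counterclockwise orientation'' and $\lnot pqr$ for the statement that it does not (i.e. it is clockwise). The axioms (for distinct points) are used as inference rules: Axiom 1 (cyclic symmetry): $pqr\implies qrp$. Axiom 2 (antisymmetry): $pqr\implies \lnot prq$. Axiom 3 (nondegeneracy): either $pqr$ or $prq$; as an inference rule, $\lnot pqr\implies prq$. Let $G$ be a graph with vertex set $S$, and let $T$ be the set of triples $abc$ of distinct points of $S$ such that at least one of $ab$, $ac$, $bc$ is an edge of $G$, each triple taken together with its true orientation in the plane. When only Axioms 1, 2 and 3 are used, $G$ is an OT-graph for $S$ if the orientation of every triple of distinct points of $S$ can be derived from the orientations of the triples in $T$ by (repeatedly) applying Axioms 1, 2 and 3. (In the unrestricted notion of OT-graph two further axioms are allowed; they are not used here.) *)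

(* Defs.v *)
From HB Require Import structures.
From mathcomp Require Import all_boot all_order all_algebra.
From mathcomp Require Import finmap.
From mathcomp Require Import boolp reals.
Set Implicit Arguments.
Unset Strict Implicit.
Unset Printing Implicit Defensive.
Import Order.TTheory GRing.Theory Num.Theory.
Local Open Scope ring_scope.

Definition collinear (R : realType) (p q r : R * R) : Prop :=
  exists a b c : R,
    [/\ (a, b) <> (0, 0), a * p.1 + b * p.2 = c,
        a * q.1 + b * q.2 = c & a * r.1 + b * r.2 = c].

Definition general_position (R : realType) (S : {fset R * R}) : Prop :=
  forall p q r : R * R, p \in S -> q \in S -> r \in S ->
    p != q -> p != r -> q != r -> ~ collinear p q r.

(* The signed area of the parallelogram spanned by q - p and r - p is
   positive. *)
Definition ccw (R : realType) (p q r : R * R) : bool :=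
  0 < (q.1 - p.1) * (r.2 - p.2) - (q.2 - p.2) * (r.1 - p.1).

Definition distinct3 (V : eqType) (p q r : V) : bool :=
  [&& p != q, p != r & q != r].

(* A simple graph on V is given by its edge set, a set of 2-element subsets. *)
Definition is_graph (V : finType) (E : {set {set V}}) : Prop :=
  forall e : {set V}, e \in E -> #|e| = 2%N.

Definition in_T (V : finType) (E : {set {set V}}) (p q r : V) : bool :=
  distinct3 p q r &&
  [|| [set p; q] \in E, [set p; r] \in E | [set q; r] \in E].

(* [derivable123 E o p q r true] stands for the derivability of "pqr" and
   [derivable123 E o p q r false] for that of "not pqr", where [o] is the true
   orientation.  Every rule preserves distinctness of the three points, so it
   only has to be required of the given triples. *)
Inductive derivable123 (V : finType) (E : {set {set V}})
    (o : V -> V -> V -> bool) : V -> V -> V -> bool -> Prop :=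
| Der_given p q r : in_T E p q r -> derivable123 E o p q r (o p q r)
| Der_cyclic p q r : derivable123 E o p q r true -> derivable123 E o q r p true
| Der_antisym p q r :
    derivable123 E o p q r true -> derivable123 E o p r q false
| Der_nondeg p q r :
    derivable123 E o p q r false -> derivable123 E o p r q true.

Definition OT123_graph (R : realType) (S : {fset R * R})
    (E : {set {set S}}) : Prop :=
  let o (p q r : S) := ccw (val p) (val q) (val r) in
  is_graph E /\
  forall p q r : S, distinct3 p q r -> derivable123 E o p q r (o p q r).

Definition OT123_size (R : realType) (S : {fset R * R}) : pred nat :=
  fun m => `[< exists E : {set {set S}}, OT123_graph E /\ #|E| = m >].

(* The complete graph is an OT-graph. *)
Lemma OT123_size_ex (R : realType) (S : {fset R * R}) :
  exists m, OT123_size S m.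
Proof.
exists #|[set e : {set S} | #|e| == 2%N]|; apply/asboolP.
exists [set e : {set S} | #|e| == 2%N]; split=> //; split.
  by move=> e; rewrite inE => /eqP.
move=> p q r dpqr; apply: Der_given; rewrite /in_T dpqr /=.
by case/and3P: dpqr => npq _ _; rewrite inE cards2 npq.
Qed.

Definition e123 (R : realType) (S : {fset R * R}) : nat :=
  ex_minn (OT123_size_ex S).

(* Main.v *)
(** A derivation never changes the underlying three points, so with Axioms 1-3
    only, G is an OT-graph iff every triple of points spans an edge of G: the
    orientations play no role, and the complement of G is triangle-free.  The
    formula is thus Mantel's theorem for the complement.  For the lower bound,
    pick u, v nonadjacent if possible; every other point is joined to u or v,
    so deleting u and v loses at least n - 2 edges.  For the upper bound, take
    two disjoint cliques of sizes n / 2 and n - n / 2. *)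

Require Import Defs.
From mathcomp Require Import all_boot all_order all_algebra.
From mathcomp Require Import finmap.
From mathcomp Require Import boolp reals.
From mathcomp Require Import zify.

Set Implicit Arguments.
Unset Strict Implicit.
Unset Printing Implicit Defensive.

(** Membership in [in_T] is invariant under all permutations of the three points, and each axiom
    merely permutes them. *)
Lemma derivable123_in_T (V : finType) (E : {set {set V}})
    (o : V -> V -> V -> bool) (p q r : V) (b : bool) :
  derivable123 E o p q r b -> in_T E p q r.
Proof.
have swap x y z : in_T E x y z -> in_T E x z y.
  rewrite /in_T /distinct3 (eq_sym z) (setUC [set z]).
  by move=> /andP[/and3P[-> -> ->] /or3P[] ->]; rewrite ?orbT.
elim=> {p q r b} // [p q r _ | p q r _ /swap | p q r _ /swap] //.
rewrite /in_T /distinct3 (eq_sym q p) (eq_sym r p) (setUC [set q] [set p]).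
by rewrite (setUC [set r] [set p]) => /andP[/and3P[-> -> ->] /or3P[] ->];
  rewrite ?orbT.
Qed.

Lemma OT123_graphP (R : realType) (S : {fset R * R}) (E : {set {set S}}) :
  OT123_graph E <->
  is_graph E /\ forall p q r : S, distinct3 p q r -> in_T E p q r.
Proof.
split=> -[graphE E3]; split=> // p q r dpqr; last exact/Der_given/E3.
exact: derivable123_in_T (E3 p q r dpqr).
Qed.

(** This counts the edges of two disjoint cliques that split [n] points as evenly as possible. *)
Lemma bin2_halves (n : nat) :
  ('C(n %/ 2, 2) + 'C(n - n %/ 2, 2) = (n %/ 2) * ((n - 1) %/ 2))%N.
Proof.
have double_bin2 k : ('C(k, 2) * 2 = k * k.-1)%N.
  by rewrite (bin_ffact k 2) ffactnS ffactn1.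
have := double_bin2 (n %/ 2)%N; have := double_bin2 (n - n %/ 2)%N.
have [halves | halves] : (n - n %/ 2 = n %/ 2 \/ n - n %/ 2 = (n %/ 2).+1)%N by lia.
- rewrite halves; have -> : ((n - 1) %/ 2 = (n %/ 2).-1)%N by lia.
  nia.
- rewrite halves; have -> : ((n - 1) %/ 2 = n %/ 2)%N by lia.
  move: (n %/ 2)%N => k; nia.
Qed.

Section Mantel.

Variable V : finType.
Implicit Types (E : {set {set V}}) (A : {set V}).

Lemma dominating_pair E A :
  (1 < #|A|)%N ->
  {in A & &, forall p q r, distinct3 p q r -> in_T E p q r} ->
  exists u v, [/\ u \in A, v \in A, u != v &
    forall w, w \in A :\: [set u; v] ->
      ([set u; w] \in E) || ([set v; w] \in E)].
Proof.
move=> /card_gt1P[u [v [uA vA neq_uv]]] E3.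
have [/existsP[a /existsP[b /and4P[aA bA neq_ab abNE]]] | complete] :=
  boolP [exists a, exists b,
    [&& a \in A, b \in A, a != b & [set a; b] \notin E]].
(* Since [a] and [b] are nonadjacent, the edge spanned by [a], [b], [w] must end at [w]. In the
   other case [A] is a clique and any pair will do. *)
- exists a, b; split=> // w; rewrite !inE negb_or.
  case/andP=> /andP[neq_wa neq_wb] wA.
  have dabw : distinct3 a b w.
    by rewrite /distinct3 neq_ab eq_sym neq_wa eq_sym neq_wb.
  by have /andP[_] := E3 a b w aA bA wA dabw; rewrite (negPf abNE).
- exists u, v; split=> // w; rewrite !inE negb_or.
  case/andP=> /andP[neq_wu _] wA.
  move: complete; rewrite negb_exists => /forallP/(_ u).
  rewrite negb_exists => /forallP/(_ w).
  by rewrite uA wA eq_sym neq_wu negbK => ->.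
Qed.

(** Each remaining [w] selects an edge to a neighbour [x w] among [u] and [v]. These edges are
    pairwise distinct and all disappear when [u] and [v] are deleted. *)
Lemma card_delete_dominating_pair E A (u v : V) :
  u \in A -> v \in A ->
  (forall w, w \in A :\: [set u; v] ->
    ([set u; w] \in E) || ([set v; w] \in E)) ->
  (#|A :\: [set u; v]| + #|[set e in E | e \subset A :\: [set u; v]]|
     <= #|[set e in E | e \subset A]|)%N.
Proof.
move=> uA vA dom; set W := A :\: [set u; v].
pose x w := if [set u; w] \in E then u else v.
have xuv w : x w \in [set u; v] by rewrite /x; case: ifP; rewrite !inE eqxx ?orbT.
have xE w : w \in W -> [set x w; w] \in E.
  by move=> /dom; rewrite /x; case: ifP.
have f_inj : {in W &, injective (fun w => [set x w; w])}.
  (* If [w] were not [w'], it would equal [x w'], which lies outside [W]. *)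
  move=> w w' wW w'W /setP/(_ w); rewrite set22 => /esym/set2P[] // eq_w.
  by move: wW; rewrite eq_w inE xuv.
rewrite -(card_in_imset f_inj) -cardsUI.
have /setP/eq_card -> :
    [set [set x w; w] | w in W] :&: [set e in E | e \subset W] = set0.
  apply/setP=> e; rewrite !inE; apply/negP=> /andP[/imsetP[w _ ->]].
  by case/andP=> _ /subsetP/(_ (x w) (set21 _ _)); rewrite inE xuv.
rewrite cards0 addn0; apply/subset_leq_card/subsetP=> e.
rewrite !inE => /orP[/imsetP[w wW ->] | /andP[-> /subset_trans -> //]];
  last exact: subsetDl.
rewrite xE // subUset !sub1set.
by have /setDP[-> _] := wW; rewrite andbT; have /set2P[->|->] := xuv w.
Qed.

(** Strong induction on the size of [A]; speaking of the edges inside a subset lets [E] stay fixed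
    while two points are removed. *)
Lemma mantel_complement_lower E A :
  {in A & &, forall p q r, distinct3 p q r -> in_T E p q r} ->
  ((#|A| %/ 2) * ((#|A| - 1) %/ 2) <= #|[set e in E | e \subset A]|)%N.
Proof.
have [m] := ubnP #|A|; elim: m A => // m IHm A leAm E3.
have [|A_gt1] := leqP #|A| 1; first by case: #|A| => [|[]].
have [u [v [uA vA neq_uv dom]]] := dominating_pair A_gt1 E3.
apply: leq_trans (card_delete_dominating_pair uA vA dom).
have cardW : #|A :\: [set u; v]| = (#|A| - 2)%N.
  rewrite cardsD (setIidPr _) ?cards2 ?neq_uv //.
  by rewrite subUset !sub1set uA vA.
apply: leq_trans (leq_add (leqnn _) (IHm (A :\: [set u; v]) _ _)).
- rewrite cardW -{1 2}(subnK A_gt1); set k := (_ - 2)%N.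
  have -> : ((k + 2) %/ 2 = k %/ 2 + 1)%N by lia.
  (* The case [k = 0] is separate because the truncated [k - 1] breaks the next identity there. *)
  case: k => [|k] //.
  have -> : ((k.+1 + 2 - 1) %/ 2 = (k.+1 - 1) %/ 2 + 1)%N by lia.
  have : (k.+1 %/ 2 + (k.+1 - 1) %/ 2 = k)%N by lia.
  nia.
- by rewrite cardW; lia.
- by move=> p q r /setDP[pA _] /setDP[qA _] /setDP[rA _]; exact: E3.
Qed.

Lemma exists_two_cliques :
  exists E, [/\ is_graph E, forall p q r, distinct3 p q r -> in_T E p q r &
    #|E| = (#|V| %/ 2 * ((#|V| - 1) %/ 2))%N].
Proof.
have [A cardA] : exists A : {set V}, #|A| = (#|V| %/ 2)%N.
  have : (0 < #|[set A : {set V} | #|A| == #|V| %/ 2]|)%N.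
    by rewrite card_draws bin_gt0 leq_div.
  by case/card_gt0P=> A; rewrite inE => /eqP; exists A.
pose pairs (B : {set V}) := [set e : {set V} | e \subset B & #|e| == 2].
exists (pairs A :|: pairs (~: A)); split.
- by move=> e; rewrite !inE => /orP[] /andP[_ /eqP].
- move=> p q r dpqr; rewrite /in_T dpqr /=; case/and3P: dpqr => pq pr qr.
  rewrite !inE !subUset !sub1set !inE !cards2 pq pr qr /=.
  (* By pigeonhole, two of the three points lie on the same side of the partition. *)
  by case: (p \in A); case: (q \in A); case: (r \in A).
have disj : pairs A :&: pairs (~: A) = set0.
  apply/setP=> e; rewrite !inE.
  apply/negP=> /andP[/andP[eA /eqP e2] /andP[eAc _]].
  have : e \subset A :&: ~: A by rewrite subsetI eA.
  by rewrite setICr subset0 => /eqP e0; rewrite e0 cards0 in e2.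
rewrite cardsU disj cards0 subn0 !cards_draws.
have -> : #|~: A| = (#|V| - #|V| %/ 2)%N by have := cardsC A; lia.
by rewrite cardA bin2_halves.
Qed.

End Mantel.

Theorem theorem4 (R : realType) (S : {fset R * R}) (n : nat) :
  #|` S|%fset = n -> (2 <= n)%N -> general_position S ->
  e123 S = ((n %/ 2) * ((n - 1) %/ 2))%N.
Proof.
move=> <- _ _; rewrite cardfE /e123; case: ex_minnP => m.
move=> /asboolP[E [/OT123_graphP[_ E3] <-]] minE; apply/eqP.
rewrite eqn_leq; apply/andP; split.
  have [F [graphF F3 <-]] := exists_two_cliques S.
  by apply: minE; apply/asboolP; exists F; split=> //; apply/OT123_graphP.
(* The lower bound is applied with [A] the whole vertex set. *)
have -> : E = [set e in E | e \subset [set: S]].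
  by apply/setP=> e; rewrite inE subsetT andbT.
rewrite -cardsT; apply: mantel_complement_lower => p q r _ _ _; exact: E3.
Qed.
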